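(* Let $C\subset\mathbb{R}^n$ be nonempty, compact and convex, let $U\subset\mathbb{R}^n$ be open and convex with $C\cap U\neq\emptyset$, and let $f:U\to\mathbb{R}$ be twice continuously differentiable and convex. Assume boundary blow-up: for every $\alpha\in\mathbb{R}$ such that $L_\alpha:=\{p\in C\cap U\mid f(p)\le\alpha\}$ is nonempty, $\operatorname{dist}(L_\alpha,U^c)>0$. Let $p^{(0)}\in C\cap U$, $\mathcal F^{(0)}:=\{p\in C\cap U\mid f(p)\le f(p^{(0)})\}$ and $\mathcal L_C:=\operatorname{lin}(C-C)$, and suppose that $$v^\top\nabla^2 f(p)v>0\quad\text{for every }p\in\mathcal F^{(0)}\text{ and every }v\in\mathcal L_C\text{ with }\|v\|=1.$$ Then $f$ has a unique minimizer $p^\star$ over $C\cap U$. Moreover, if $\mathcal L_C\neq\{0\}$ and $$\mu:=\min_{p\in\mathcal F^{(0)},\ v\in\mathcal L_C,\ \|v\|=1}v^\top\nabla^2 f(p)v,$$ then any sequence $\{p^{(k)}\}$ generated before termination by the domain-aware Armijo projected gradient method (described in the context) started at $p^{(0)}$ with parameters $\bar\alpha>0$, $\sigma,\rho\in(0,1)$, $\varepsilon\ge0$ satisfies $$\|p^{(k)}-p^\star\|\le\sqrt{\frac{2\big(f(p^{(0)})-f(p^\star)\big)}{\mu}}\;\gamma^{k/2},\qquad\text{where }\ \gamma:=1-\sigma\min\{1,\mu\underline\alpha\}\in(0,1).$$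
   Context: $\|\cdot\|$ is the Euclidean norm, $\|\cdot\|_2$ the spectral norm of a matrix, $P_C$ the Euclidean projection onto $C$, $U^c=\mathbb{R}^n\setminus U$, and $\operatorname{dist}(A,B)=\inf\{\|a-b\|: a\in A,b\in B\}$, with the convention $\operatorname{dist}(A,\emptyset)=+\infty$; $\operatorname{dist}(q,B)=\operatorname{dist}(\{q\},B)$. $C-C=\{p-q\mid p,q\in C\}$ and $\operatorname{lin}$ denotes linear span. The constant $\underline\alpha$: let $d:=\operatorname{dist}(\mathcal F^{(0)},U^c)$, $r:=\min\{1,d/2\}$, $\mathcal K_r:=\{q\in\mathbb{R}^n\mid \operatorname{dist}(q,\mathcal F^{(0)})\le r\}$ (under the hypotheses $d>0$ and $\mathcal K_r$ is a compact subset of $U$), $G:=\max\{1,\max_{p\in\mathcal F^{(0)}}\|\nabla f(p)\|\}$, $L:=\max\{1,\max_{q\in\mathcal K_r}\|\nabla^2 f(q)\|_2\}$, $\alpha_\star:=\min\{r/G,\,2(1-\sigma)/L\}$, and $\underline\alpha:=\min\{\bar\alpha,\rho\alpha_\star\}>0$. Domain-aware Armijo projected gradient method. Input: $p^{(0)}\in C\cap U$, $\bar\alpha>0$, $\sigma,\rho\in(0,1)$, $\varepsilon\ge0$. For $k=0,1,\dots$: (backtracking loop) start with $\alpha:=\bar\alpha$ and repeat: set $q:=P_C(p^{(k)}-\alpha\nabla f(p^{(k)}))$; if $q\in U$ and (tested only when $q\in U$) $f(q)\le f(p^{(k)})+\sigma\nabla f(p^{(k)})^\top(q-p^{(k)})$,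 accept the trial by setting $\alpha_k:=\alpha$, $\tilde p^{(k)}:=q$ and exit the loop; otherwise replace $\alpha$ by $\rho\alpha$ and repeat. After acceptance, if $\|\tilde p^{(k)}-p^{(k)}\|/\alpha_k\le\varepsilon$, terminate and return $p^{(k)}$; otherwise set $p^{(k+1)}:=\tilde p^{(k)}$. *)

(* Defs.v *)
From HB Require Import structures.
From mathcomp Require Import all_boot all_order all_algebra.
From mathcomp Require Import all_classical all_reals all_analysis.

Set Implicit Arguments.
Unset Strict Implicit.
Unset Printing Implicit Defensive.

Import Order.TTheory GRing.Theory Num.Theory.
Import numFieldNormedType.Exports.

Local Open Scope classical_set_scope.
Local Open Scope ring_scope.

(* Vectors of R^n are row vectors 'rV[R]_n.  The library norm `|_| on matrices
   is the sup norm: it is used only for the topology (open, compact,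
   differentiable, continuous), where it agrees with the Euclidean norm. *)

Definition dot (R : realType) (n : nat) (u v : 'rV[R]_n) : R :=
  (u *m v^T) 0 0.

Definition enorm (R : realType) (n : nat) (v : 'rV[R]_n) : R :=
  Num.sqrt (dot v v).

Definition qform (R : realType) (n : nat) (A : 'M[R]_n) (v : 'rV[R]_n) : R :=
  (v *m A *m v^T) 0 0.

(* A acts on columns: v *m A^T is the transpose of the column A *m v^T. *)
Definition spectral_norm (R : realType) (n : nat) (A : 'M[R]_n) : R :=
  sup [set enorm (v *m A^T) | v in [set v : 'rV[R]_n | enorm v <= 1]].

(* The value is +oo when A or B is empty. *)
Definition set_dist (R : realType) (n : nat) (A B : set 'rV[R]_n) : \bar R :=
  ereal_inf [set (enorm (a - b))%:E | a in A & b in B].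

Definition set_diff (R : realType) (n : nat) (A B : set 'rV[R]_n)
  : set 'rV[R]_n := [set a - b | a in A & b in B].

Definition lin (R : realType) (n : nat) (A : set 'rV[R]_n) : set 'rV[R]_n :=
  [set v | exists (m : nat) (a : 'I_m -> R) (w : 'I_m -> 'rV[R]_n),
     (forall i, A (w i)) /\ v = \sum_(i < m) a i *: w i].

Definition is_max (R : realType) (A : set R) (m : R) : Prop :=
  A m /\ ubound A m.

Definition is_min (R : realType) (A : set R) (m : R) : Prop :=
  A m /\ lbound A m.

(* Junk value if the maximum (resp. minimum) is not attained. *)
Definition set_max (R : realType) (A : set R) : R := get (is_max A).

Definition set_min (R : realType) (A : set R) : R := get (is_min A).

Definition is_minimizer (R : realType) (n : nat) (f : 'rV[R]_n -> R)
    (D : set 'rV[R]_n) (p : 'rV[R]_n) : Prop :=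
  D p /\ forall q, D q -> f p <= f q.

(* The minimizer is unique whenever C is nonempty, compact and convex. *)
Definition proj (R : realType) (n : nat) (C : set 'rV[R]_n) (x : 'rV[R]_n)
  : 'rV[R]_n :=
  get (is_minimizer (fun q => enorm (x - q)) C).

Definition grad (R : realType) (n : nat) (f : 'rV[R]_n -> R) (p : 'rV[R]_n)
  : 'rV[R]_n := \row_(i < n) 'D_(delta_mx 0 i) f p.

(* Entry (i, j) is the i-th partial derivative of the j-th component of grad f. *)
Definition hess (R : realType) (n : nat) (f : 'rV[R]_n -> R) (p : 'rV[R]_n)
  : 'M[R]_n := 'J (grad f) p.

(* A function U -> R is represented by a total function whose values off U are
   irrelevant; since U is open, the derivatives at points of U depend only on
   the restriction to U. *)
Definition twice_cont_diff (R : realType) (n : nat) (U : set 'rV[R]_n)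
    (f : 'rV[R]_n -> R) : Prop :=
  forall p, U p ->
    [/\ differentiable f p, differentiable (grad f) p
      & {for p, continuous (hess f)}].

Definition sublevel (R : realType) (n : nat) (D : set 'rV[R]_n)
    (f : 'rV[R]_n -> R) (a : R) : set 'rV[R]_n :=
  [set p | D p /\ f p <= a].

(* In what follows F stands for the initial sublevel set. *)

Definition curvatures (R : realType) (n : nat) (f : 'rV[R]_n -> R)
    (F V : set 'rV[R]_n) : set R :=
  [set c | exists p v, [/\ F p, V v, enorm v = 1 & c = qform (hess f p) v]].

(* The minimum of 1 and d/2 is taken in \bar R since d = +oo when U = R^n. *)
Definition radius (R : realType) (n : nat) (U F : set 'rV[R]_n) : R :=
  fine (Order.min 1%E (set_dist F (~` U) * (2^-1)%:E)%E).

Definition thickening (R : realType) (n : nat) (F : set 'rV[R]_n) (r : R)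
  : set 'rV[R]_n :=
  [set q | (set_dist [set q] F <= r%:E)%E].

Definition grad_bound (R : realType) (n : nat) (f : 'rV[R]_n -> R)
    (F : set 'rV[R]_n) : R :=
  Num.max 1 (set_max [set enorm (grad f p) | p in F]).

Definition hess_bound (R : realType) (n : nat) (f : 'rV[R]_n -> R)
    (K : set 'rV[R]_n) : R :=
  Num.max 1 (set_max [set spectral_norm (hess f q) | q in K]).

Definition alpha_star (R : realType) (n : nat) (U : set 'rV[R]_n)
    (f : 'rV[R]_n -> R) (F : set 'rV[R]_n) (sigma : R) : R :=
  let r := radius U F in
  Num.min (r / grad_bound f F)
          (2 * (1 - sigma) / hess_bound f (thickening F r)).

Definition alpha_low (R : realType) (n : nat) (U : set 'rV[R]_n)
    (f : 'rV[R]_n -> R) (F : set 'rV[R]_n) (abar sigma rho : R) : R :=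
  Num.min abar (rho * alpha_star U f F sigma).

Definition trial (R : realType) (n : nat) (C : set 'rV[R]_n)
    (f : 'rV[R]_n -> R) (x : 'rV[R]_n) (a : R) : 'rV[R]_n :=
  proj C (x - a *: grad f x).

Definition accepted (R : realType) (n : nat) (C U : set 'rV[R]_n)
    (f : 'rV[R]_n -> R) (sigma : R) (x : 'rV[R]_n) (a : R) : Prop :=
  let q := trial C f x a in
  U q /\ f q <= f x + sigma * dot (grad f x) (q - x).

(* backtrack ... x a b: the loop at x, entered with step size a, exits with b. *)
Inductive backtrack (R : realType) (n : nat) (C U : set 'rV[R]_n)
    (f : 'rV[R]_n -> R) (sigma rho : R) (x : 'rV[R]_n) : R -> R -> Prop :=
| backtrack_accept a :
    accepted C U f sigma x a -> backtrack C U f sigma rho x a a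
| backtrack_shrink a b :
    ~ accepted C U f sigma x a ->
    backtrack C U f sigma rho x (rho * a) b ->
    backtrack C U f sigma rho x a b.

(* One non-terminating iteration of the method, from x to y. *)
Definition armijo_step (R : realType) (n : nat) (C U : set 'rV[R]_n)
    (f : 'rV[R]_n -> R) (abar sigma rho eps : R) (x y : 'rV[R]_n) : Prop :=
  exists a : R,
    [/\ backtrack C U f sigma rho x abar a,
        y = trial C f x a
      & eps < enorm (y - x) / a].

(* p 0, ..., p k are generated from p0 without terminating before index k;
   the later values of p are unconstrained. *)
Definition armijo_iterates (R : realType) (n : nat) (C U : set 'rV[R]_n)
    (f : 'rV[R]_n -> R) (abar sigma rho eps : R) (p0 : 'rV[R]_n)
    (p : nat -> 'rV[R]_n) (k : nat) : Prop :=
  p 0%N = p0 /\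
  forall j, (j < k)%N -> armijo_step C U f abar sigma rho eps (p j) (p j.+1).

(* Main.v *)
Require Import Defs.
From HB Require Import structures.
From mathcomp Require Import all_boot all_order all_algebra.
From mathcomp Require Import all_classical all_reals all_analysis.
From mathcomp Require Import ring lra.

Set Implicit Arguments.
Unset Strict Implicit.
Unset Printing Implicit Defensive.

Import Order.TTheory GRing.Theory Num.Theory.
Import numFieldNormedType.Exports.

Local Open Scope classical_set_scope.
Local Open Scope ring_scope.

(** The initial sublevel set [F0] is a closed subset of [C]: a limit point of
    [F0] cannot leave [U], because [F0] stays at positive distance from the
    complement of [U], and then [f] is continuous there
    ([sublevel_compact]).  Hence [F0] is compact, [f] attains its minimum on
    it, and the curvatures of [f] along unit vectors of the span of [C - C]
    have a positive minimum [mu]: they are the values of a continuous function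
    on the product of [F0] with a compact sphere, and the span is closed since
    it is the row space of a matrix ([lin_closed]).

    The set [F0] is convex, so a second-order Taylor expansion along its
    segments turns the curvature bound into strong convexity of [f] on [F0]
    ([strong_convexity_curvature]).  Strong convexity makes [f] grow
    quadratically away from its minimizer ([quadratic_growth]); this gives
    uniqueness, and reduces the bound on the distances to a bound on the
    values of [f].

    For the values, two facts about one step from [x] in [F0] are combined.
    First, every step size up to [alpha_star] passes the Armijo test
    ([small_step_accepted]): the trial step is no longer than the radius of a
    neighbourhood of [F0] inside [U] on which the Hessian is bounded, and the
    variational inequality of the projection makes the linear decrease
    dominate the quadratic error.  So backtracking returns a step size of at
    least [alpha_low] ([backtrack_ge]).  Second, the trial point minimizes over
    [C] the model [y |-> dot (grad f x) (y - x) + |y - x|^2 / (2 a)].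
    Comparing it with the point of the segment from [x] to the minimizer at
    parameter [min 1 (mu * a)], and absorbing the quadratic term by strong
    convexity, shows that an accepted step contracts the gap
    [f x - f pstar] by the factor [1 - sigma * min 1 (mu * a)]
    ([armijo_contraction]).  Induction on the iterations
    ([iterates_contract]) concludes. *)

(** * Euclidean geometry *)

Section euclidean.
Context (R : realType) (n : nat).
Implicit Types (u v w : 'rV[R]_n) (a : R).

Lemma dotE u v : dot u v = \sum_i u 0 i * v 0 i.
Proof. by rewrite /dot mxE; apply: eq_bigr => i _; rewrite mxE. Qed.

Lemma dotC u v : dot u v = dot v u.
Proof. by rewrite !dotE; apply: eq_bigr => i _; rewrite mulrC. Qed.

Lemma dotDl u v w : dot (u + v) w = dot u w + dot v w.
Proof. by rewrite /dot mulmxDl mxE. Qed.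

Lemma dotZl a u v : dot (a *: u) v = a * dot u v.
Proof. by rewrite /dot -scalemxAl mxE. Qed.

Lemma dotNl u v : dot (- u) v = - dot u v.
Proof. by rewrite -scaleN1r dotZl mulN1r. Qed.

Lemma dotDr u v w : dot u (v + w) = dot u v + dot u w.
Proof. by rewrite dotC dotDl !(dotC u). Qed.

Lemma dotZr a u v : dot u (a *: v) = a * dot u v.
Proof. by rewrite dotC dotZl dotC. Qed.

Lemma dotNr u v : dot u (- v) = - dot u v.
Proof. by rewrite dotC dotNl dotC. Qed.

Lemma dot0l v : dot 0 v = 0.
Proof. by rewrite -(scale0r v) dotZl mul0r. Qed.

Definition dot_lin := (dotDl, dotDr, dotNl, dotNr, dotZl, dotZr).

Lemma dot_ge0 v : 0 <= dot v v.
Proof. by rewrite dotE sumr_ge0// => i _; rewrite -expr2 sqr_ge0. Qed.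

Lemma enorm_ge0 v : 0 <= enorm v.
Proof. exact: sqrtr_ge0. Qed.

Lemma enorm_sqr v : enorm v ^+ 2 = dot v v.
Proof. by rewrite sqr_sqrtr// dot_ge0. Qed.

Lemma coord_le_enorm v i : `|v 0 i| <= enorm v.
Proof.
rewrite -sqrtr_sqr ler_sqrt ?dot_ge0// dotE (bigD1 i)//= -expr2 lerDl.
by rewrite sumr_ge0// => j _; rewrite -expr2 sqr_ge0.
Qed.

Lemma enorm_eq0 v : enorm v = 0 -> v = 0.
Proof.
move=> v0; apply/rowP => i; rewrite mxE; apply/eqP; rewrite -normr_le0 -v0.
exact: coord_le_enorm.
Qed.

Lemma enormZ a v : enorm (a *: v) = `|a| * enorm v.
Proof.
by rewrite /enorm !dot_lin mulrA -expr2 sqrtrM ?sqr_ge0// sqrtr_sqr.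
Qed.

Lemma enormN v : enorm (- v) = enorm v.
Proof. by rewrite -scaleN1r enormZ normrN normr1 mul1r. Qed.

Lemma enorm0 : enorm (0 : 'rV[R]_n) = 0.
Proof. by rewrite -(scale0r (0 : 'rV[R]_n)) enormZ normr0 mul0r. Qed.

Lemma cauchy_schwarz u v : `|dot u v| <= enorm u * enorm v.
Proof.
rewrite -(@ler_pXn2r _ 2)// ?nnegrE ?mulr_ge0 ?enorm_ge0//.
rewrite real_normK ?num_real// exprMn !enorm_sqr.
have [v0|v0] := eqVneq (dot v v) 0.
  have -> : v = 0 by apply: enorm_eq0; rewrite /enorm v0 sqrtr0.
  by rewrite dotC !dot0l expr0n/= mulr0.
have vgt0 : 0 < dot v v by rewrite lt_neqAle eq_sym v0 dot_ge0.
(* the vector is |v|^2 times the component of u orthogonal to v *)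
have := dot_ge0 (dot v v *: u - dot u v *: v).
rewrite !dot_lin (dotC v u) => h.
rewrite -(ler_pM2l vgt0) -subr_ge0; apply: le_trans h _.
by rewrite le_eqVlt; apply/orP; left; apply/eqP; ring.
Qed.

End euclidean.

(** The limit step of first-order arguments along a segment: a bound by [t * b]
    for small [t] is a bound by [0]. *)
Lemma le0_of_le_small (R : realFieldType) (a b : R) :
  (forall t, 0 < t < 1 -> a <= t * b) -> a <= 0.
Proof.
move=> h; rewrite leNgt; apply/negP => a0.
have b0 : 0 < b by have := h (2^-1); lra.
have ab : 0 < a + b by lra.
have a_lt : a / (a + b) < 1 by rewrite ltr_pdivrMr// mul1r; lra.
have b_lt : b / (a + b) < 1 by rewrite ltr_pdivrMr// mul1r; lra.
have a_gt : 0 < a / (a + b) by rewrite divr_gt0.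
(* at this t the bound t * b is less than a / 2 *)
have t01 : 0 < a / (a + b) / 2 < 1 by lra.
have := h _ t01.
have -> : a / (a + b) / 2 * b = a * (b / (a + b) / 2) by ring.
nra.
Qed.

(** * Limits and derivatives along lines *)

Section matrix_limits.
Context (R : realType) (T : Type) (F : set_system T) {FF : Filter F}.

Lemma mx_cvg m n (M : T -> 'M[R]_(m, n)) (A : 'M[R]_(m, n)) :
  (forall i j, M t i j @[t --> F] --> A i j) -> M @ F --> A.
Proof.
move=> MA S [P AP PS] /=.
rewrite /= nbhs_filterE; apply: (filterS (fun t => PS (M t))) => /=.
apply: filter_forall => i; apply: filter_forall => j.
exact: (MA i j _ (AP i j)).
Qed.

Lemma coord_cvg m n (M : T -> 'M[R]_(m, n)) (A : 'M[R]_(m, n)) i j :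
  M @ F --> A -> M t i j @[t --> F] --> A i j.
Proof.
by move=> MA; apply: (cvg_comp M (fun N : 'M[R]_(m, n) => N i j) MA);
  exact: coord_continuous.
Qed.

Lemma trmx_cvg m n (M : T -> 'M[R]_(m, n)) (A : 'M[R]_(m, n)) :
  M @ F --> A -> (M t)^T @[t --> F] --> A^T.
Proof.
move=> MA; apply: mx_cvg => i j.
rewrite mxE (_ : (fun _ => _) = fun t => M t j i).
  exact: coord_cvg.
by apply/funext => t; rewrite mxE.
Qed.

Lemma mulmx_cvg m n q (M : T -> 'M[R]_(m, n)) (N : T -> 'M[R]_(n, q))
    (A : 'M[R]_(m, n)) (B : 'M[R]_(n, q)) :
  M @ F --> A -> N @ F --> B -> M t *m N t @[t --> F] --> A *m B.
Proof.
move=> MA NB; apply: mx_cvg => i j.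
rewrite mxE (_ : (fun _ => _) = fun t => \sum_k M t i k * N t k j); last first.
  by apply/funext => t; rewrite mxE.
apply: cvg_big => [|k _]; first exact: add_continuous.
by apply: cvgM; exact: coord_cvg.
Qed.

Lemma dot_cvg n (u w : T -> 'rV[R]_n) (a b : 'rV[R]_n) :
  u @ F --> a -> w @ F --> b -> dot (u t) (w t) @[t --> F] --> dot a b.
Proof.
move=> ua wb; have := mulmx_cvg ua (trmx_cvg wb) => uw.
exact: coord_cvg uw.
Qed.

Lemma enorm_cvg n (u : T -> 'rV[R]_n) (a : 'rV[R]_n) :
  u @ F --> a -> enorm (u t) @[t --> F] --> enorm a.
Proof.
move=> ua; apply: (cvg_comp _ (@Num.sqrt R) (dot_cvg ua ua)).
exact: sqrt_continuous.
Qed.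

Lemma qform_cvg n (M : T -> 'M[R]_n) (u : T -> 'rV[R]_n)
    (A : 'M[R]_n) (a : 'rV[R]_n) :
  M @ F --> A -> u @ F --> a -> qform (M t) (u t) @[t --> F] --> qform A a.
Proof.
move=> MA ua; have := mulmx_cvg (mulmx_cvg ua MA) (trmx_cvg ua) => uw.
exact: coord_cvg uw.
Qed.

End matrix_limits.

Lemma enorm_continuous (R : realType) n : continuous (@enorm R n).
Proof. by move=> v; exact: (enorm_cvg (@cvg_id _ (nbhs v))). Qed.

Lemma dist_continuous (R : realType) n (q : 'rV[R]_n) :
  continuous (fun p : 'rV[R]_n => enorm (q - p)).
Proof.
move=> p; exact: (@enorm_cvg _ _ (nbhs p) _ n (fun y => q - y) _
  (cvgB (cvg_cst q) (@cvg_id _ (nbhs p)))).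
Qed.

Section line.
Context (R : realType) (n : nat).
Implicit Types (x v p : 'rV[R]_n) (f : 'rV[R]_n -> R).

(** The values are in the regular module, so that this is a linear map of normed
    spaces and has a differential. *)
Definition dotr v : 'rV[R]_n -> R^o := fun u => dot u v.

Lemma dotr_is_linear v : linear (dotr v).
Proof. by move=> a u w; rewrite /dotr dotDl dotZl. Qed.

HB.instance Definition _ v :=
  GRing.isLinear.Build R 'rV[R]_n R^o *:%R (dotr v) (dotr_is_linear v).

Lemma is_derive_line (W : normedModType R) (F : 'rV[R]_n -> W) x v t :
  differentiable F (x + t *: v) ->
  is_derive (t : R) 1 (fun s : R => F (x + s *: v)) ('d F (x + t *: v) v).
Proof.
move=> dF.
have dl : is_diff (t : R^o) (fun s : R^o => x + s *: v) ( *:%R^~ v).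
  by apply: is_diff_eq; rewrite add0r.
have dF' := differentiableP dF.
have dc := @is_diff_comp _ _ _ _ _ _ _ _ _ dl dF'.
have := @ex_diff _ _ _ _ _ _ _ dc => dif.
split; first exact: diff_derivable.
by rewrite deriveE// diff_val /= scale1r.
Qed.

Lemma diff_grad f p v : differentiable f p -> 'd f p v = dot (grad f p) v.
Proof.
move=> df; rewrite dotE {1}(row_sum_delta v) linear_sum.
apply: eq_bigr => i _.
by rewrite linearZ/= mxE deriveE// mulrC.
Qed.

Lemma dotr_continuous v : continuous (dotr v).
Proof. by move=> q; exact: (dot_cvg (@cvg_id _ (nbhs q)) (cvg_cst v)). Qed.

Lemma differentiable_dot_grad f p v : differentiable (grad f) p ->
  differentiable (dotr v \o grad f) p.
Proof.
by move=> df; apply: differentiable_comp => //;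
  exact/linear_differentiable/dotr_continuous.
Qed.

(** The Hessian is the Jacobian of the gradient, so its quadratic form at [v] is
    the derivative along [v] of the slope of [f] in direction [v]. *)
Lemma diff_dot_grad f p v : differentiable (grad f) p ->
  'd (dotr v \o grad f) p v = qform (hess f p) v.
Proof.
move=> df; rewrite diff_comp//; last first.
  exact/linear_differentiable/dotr_continuous.
rewrite /= diff_lin; last exact: dotr_continuous.
by rewrite /dotr /qform /hess /jacobian /dot mul_rV_lin1.
Qed.

End line.

(** * Convexity and second-order Taylor bounds *)

(** Convexity of sets and functions quantifies over weights bundled with their
    bounds; one bundled weight has to serve for points and for values at once. *)
Lemma conv_weight (R : realType) (E : lmodType R) (t : R) (t01 : 0 <= t <= 1) :
  exists l : {i01 R},
    (forall x y : convex_lmodType E,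
      conv l x y = t *: (x : E) + (1 - t) *: (y : E)) /\
    (forall a b : R^o, conv l a b = t * a + (1 - t) * b).
Proof.
move/andP: t01 => [t0 t1]; exists (Itv01 t0 t1).
split => // a b; exact: convRE.
Qed.

Lemma convex_set_segment (R : realType) (n : nat) (A : set 'rV[R]_n)
    x y (t : R) :
  convex_set A -> A x -> A y -> 0 <= t <= 1 -> A (x + t *: (y - x)).
Proof.
move=> cA Ax Ay t01; have [l [lE _]] := @conv_weight R 'rV[R]_n t t01.
have := cA y x l; rewrite !inE => /(_ Ay Ax); rewrite lE.
by rewrite scalerBl scale1r addrA [t *: y + x]addrC -addrA -scalerBr.
Qed.

Lemma convex_function_segment (R : realType) (n : nat) (U : set 'rV[R]_n)
    f x y (t : R) :
  convex_function U f -> U x -> U y -> 0 <= t <= 1 ->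
  f (x + t *: (y - x)) <= t * f y + (1 - t) * f x.
Proof.
move=> cf Ux Uy t01; have [l [lE lR]] := @conv_weight R 'rV[R]_n t t01.
have := cf l y x; rewrite !inE => /(_ Uy Ux); rewrite lE lR.
by rewrite scalerBl scale1r addrA [t *: y + x]addrC -addrA -scalerBr.
Qed.

(** The mean value theorem is applied twice: to the first derivative, and then
    to the function minus its quadratic lower model. *)
Lemma taylor2_ge (R : realType) (phi phi1 phi2 : R -> R) (m : R) :
  (forall t : R, 0 <= t <= 1 -> is_derive t 1 phi (phi1 t)) ->
  (forall t : R, 0 <= t <= 1 -> is_derive t 1 phi1 (phi2 t)) ->
  (forall t : R, 0 <= t <= 1 -> m <= phi2 t) ->
  phi 0 + phi1 0 + m / 2 <= phi 1.
Proof.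
move=> d1 d2 hm.
have cont (g g1 : R -> R) (a : R) : a <= 1 ->
    (forall t : R, 0 <= t <= 1 -> is_derive t 1 g (g1 t)) ->
    {within `[0, a], continuous g}.
  move=> a1 dg; apply: derivable_within_continuous => t /itvP tI.
  by have [] := dg t _ => //; rewrite tI (le_trans _ a1)// tI.
have slope (t : R) : 0 <= t <= 1 -> phi1 0 + m * t <= phi1 t.
  move=> /andP[t0 t1].
  have [||c /itvP cI e] := @MVT_segment R phi1 phi2 0 t t0.
  - by move=> x /itvP xI; apply: d2; rewrite xI (le_trans _ t1)// xI.
  - exact: cont d2.
  rewrite -lerBrDl e subr0 ler_wpM2r//; apply: hm.
  by rewrite cI (le_trans _ t1)// cI.
pose psi t := phi t - m / 2 * t ^+ 2.
have dpsi (t : R) : 0 <= t <= 1 -> is_derive t 1 psi (phi1 t - m * t).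
  move=> t01; have d1t := d1 t t01.
  apply: is_derive_eq; rewrite /GRing.scale/=; lra.
have [||c /itvP cI] := @MVT_segment R psi (fun t => phi1 t - m * t) 0 1 ler01.
- by move=> x /itvP xI; apply: dpsi; rewrite !xI.
- exact: cont dpsi.
rewrite /psi expr0n expr1n subr0 mulr1 mulr0 subr0/=.
have := slope c; rewrite !cI => /(_ isT); lra.
Qed.

Section taylor.
Context (R : realType) (n : nat) (U : set 'rV[R]_n) (f : 'rV[R]_n -> R).
Hypothesis f_C2 : twice_cont_diff U f.

Lemma taylor_ge x v m :
  (forall t : R, 0 <= t <= 1 -> U (x + t *: v)) ->
  (forall t : R, 0 <= t <= 1 -> m <= qform (hess f (x + t *: v)) v) ->
  f x + dot (grad f x) v + m / 2 <= f (x + v).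
Proof.
move=> Uv hm.
have := @taylor2_ge R (fun t => f (x + t *: v))
  (fun t => dot (grad f (x + t *: v)) v)
  (fun t => qform (hess f (x + t *: v)) v) m.
rewrite scale0r addr0 scale1r; apply => // t /Uv/f_C2[df dg _].
  by rewrite -diff_grad//; exact: is_derive_line.
rewrite -diff_dot_grad//.
exact: (is_derive_line (differentiable_dot_grad v dg)).
Qed.

Lemma taylor_le x v m :
  (forall t : R, 0 <= t <= 1 -> U (x + t *: v)) ->
  (forall t : R, 0 <= t <= 1 -> qform (hess f (x + t *: v)) v <= m) ->
  f (x + v) <= f x + dot (grad f x) v + m / 2.
Proof.
move=> Uv hm.
have := @taylor2_ge R (fun t => - f (x + t *: v))
  (fun t => - dot (grad f (x + t *: v)) v)
  (fun t => - qform (hess f (x + t *: v)) v) (- m).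
rewrite scale0r addr0 scale1r => h.
suff : - f x - dot (grad f x) v + - m / 2 <= - f (x + v) by lra.
apply: h => t t01; last by rewrite lerN2 hm.
  have [df dg _] := f_C2 (Uv _ t01).
  rewrite -diff_grad//; have := is_derive_line df; exact: is_deriveN.
have [df dg _] := f_C2 (Uv _ t01).
rewrite -diff_dot_grad//.
have := is_derive_line (differentiable_dot_grad v dg); exact: is_deriveN.
Qed.

End taylor.

(** * Minima on compact sets and projections *)

Lemma continuous_compact_min (R : realType) (T : topologicalType) (K : set T)
    (g : T -> R) :
  K !=set0 -> compact K -> (forall x, K x -> {for x, continuous g}) ->
  exists2 c, K c & forall x, K x -> g c <= g x.
Proof.
move=> K0 cK gc; have [|c /set_mem Kc h] := compact_EVT_min K0 cK (f := g).
  by apply: continuous_in_subspaceT => x /set_mem; exact: gc.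
by exists c => // x Kx; apply: h; exact: mem_set.
Qed.

Section projection.
Context (R : realType) (n : nat) (C : set 'rV[R]_n).
Hypotheses (C0 : C !=set0) (cC : compact C) (vC : convex_set C).
Implicit Types x y : 'rV[R]_n.

Lemma projP x :
  is_minimizer (fun q : 'rV[R]_n => enorm (x - q)) C (Defs.proj C x).
Proof.
rewrite /Defs.proj; apply: getPex.
have [|c Cc h] := continuous_compact_min C0 cC
    (g := fun q : 'rV[R]_n => enorm (x - q)).
  by move=> q _; exact: dist_continuous.
by exists c.
Qed.

Lemma proj_in x : C (Defs.proj C x). Proof. by have [] := projP x. Qed.

Lemma proj_le x y : C y ->
  dot (x - Defs.proj C x) (x - Defs.proj C x) <= dot (x - y) (x - y).
Proof.
move=> Cy; have [_ /(_ y Cy)] := projP x.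
by rewrite /enorm ler_sqrt ?dot_ge0.
Qed.

(** Moving from the projection towards [y] by a fraction [t] changes half the
    squared distance to [x] by [- t * dot (x - q) (y - q)] up to a term of order
    [t ^ 2], and this cannot be a decrease. *)
Lemma proj_variational x y : C y ->
  dot (x - Defs.proj C x) (y - Defs.proj C x) <= 0.
Proof.
move=> Cy; pose q := Defs.proj C x; rewrite -/q.
rewrite -(@pmulr_rle0 _ 2)//.
apply: (@le0_of_le_small _ _ (dot (y - q) (y - q))).
move=> t /andP[t0 t1].
have t01 : 0 <= t <= 1 by rewrite !ltW.
have := proj_le x (convex_set_segment vC (proj_in x) Cy t01); rewrite -/q.
rewrite opprD addrA; move: (x - q) (y - q) => a b.
rewrite !dot_lin (dotC b a) => h; rewrite -(ler_pM2l t0); nra.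
Qed.

End projection.

(** * Linear spans *)

Section span.
Context (R : realType) (n : nat).
Implicit Types (A : set 'rV[R]_n) (v w : 'rV[R]_n).

Lemma lin_mem A v : A v -> lin A v.
Proof.
move=> Av; exists 1%N, (fun=> 1), (fun=> v).
by rewrite big_ord1 scale1r.
Qed.

Lemma lin0 A : lin A 0.
Proof.
by exists 0%N, (fun=> 0), (fun=> 0); split => [[]//|]; rewrite big_ord0.
Qed.

Lemma linZ A a v : lin A v -> lin A (a *: v).
Proof.
move=> [m [b [w [Aw ->]]]]; exists m, (fun i => a * b i), w; split => //.
by rewrite scaler_sumr; apply: eq_bigr => i _; rewrite scalerA.
Qed.

(** Among the matrices whose rows are in [A], one of maximal rank spans [A]: an
    element of [A] outside its row space would be a further independent row. *)
Lemma lin_row_space A :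
  exists (m : nat) (W : 'M[R]_(m, n)), forall v, lin A v <-> (v <= W)%MS.
Proof.
pose P k := `[< exists m (W : 'M[R]_(m, n)),
  (forall i, A (row i W)) /\ \rank W = k >].
have P0 : exists k, P k.
  exists 0%N; apply/asboolP; exists 0%N, 0; split; first by case.
  by rewrite mxrank0.
have Pn k : P k -> (k <= n)%N.
  by move=> /asboolP[m [W [_ <-]]]; exact: rank_leq_col.
have [_ /asboolP[m [W [AW <-]]] Wmax] := ex_maxnP P0 Pn.
exists m, W => v; split=> [[k [a [w [Aw ->]]]]|/submxP[D ->]].
  apply: summx_sub => i _; apply: scalemx_sub.
  have : P (\rank (col_mx W (w i))).
    apply/asboolP; exists (m + 1)%N, (col_mx W (w i)); split => // j.
    case: (split_ordP j) => l ->; first by rewrite rowKu.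
    by rewrite rowKd row_id.
  move=> /Wmax; rewrite -addsmxE => le.
  have := mxrank_leqif_eq (addsmxSl W (w i)).
  rewrite /leqif eq_sym eqn_leq => -[-> /=]; rewrite le => /esym.
  by move=> /eqmxP/eqmx_sym e; rewrite -e addsmxSr.
exists m, (fun i => D 0 i), (fun i => row i W); split => //.
by rewrite mulmx_sum_row.
Qed.

Lemma lin_closed A : closed (lin A).
Proof.
have [m [W WP]] := lin_row_space A.
have -> : lin A = (fun v => v *m cokermx W) @^-1` [set 0].
  apply/seteqP; split => v /=; rewrite WP submxE => /eqP //.
apply: closed_comp.
  move=> v _; exact: (@mulmx_cvg _ _ (nbhs v) _ _ _ _ id (fun=> cokermx W)
    _ _ (@cvg_id _ (nbhs v)) (cvg_cst _)).
exact: (@accessible_closed_set1 _ (hausdorff_accessible (@norm_hausdorff _ _))).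
Qed.

End span.

(** * Compactness and distance to the complement *)

Section compactness.
Context (R : realType) (n : nat).
Implicit Types (A B F : set 'rV[R]_n) (v w p q : 'rV[R]_n).

Lemma enorm_bounded_compact A M :
  closed A -> (forall v, A v -> enorm v <= M) -> compact A.
Proof.
move=> cA AM; apply: bounded_closed_compact => //.
exists M; split; first exact: num_real.
move=> M' MM' v /AM vM.
have M0 : 0 <= M by rewrite (le_trans (enorm_ge0 v)).
rewrite /Num.Def.normr/= mx_normrE.
apply: bigmax_le => [|[i j] _ /=]; first by rewrite (le_trans M0)// ltW.
by rewrite ord1 (le_trans (coord_le_enorm _ _))// (le_trans vM)// ltW.
Qed.

Lemma set_dist_le A B a b : A a -> B b ->
  (set_dist A B <= (enorm (a - b))%:E)%E.
Proof.
by move=> Aa Bb; apply: ereal_inf_lbound; exists a => //; exists b.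
Qed.

(** The distance to a compact set is attained. *)
Lemma thickeningP F r q : F !=set0 -> compact F ->
  thickening F r q <-> exists2 p, F p & enorm (q - p) <= r.
Proof.
move=> F0 cF; split => [|[p Fp pr]]; last first.
  by apply: le_trans (set_dist_le _ Fp) _ => //; rewrite lee_fin.
have [p _|c Fc h] := continuous_compact_min F0 cF
    (g := fun p : 'rV[R]_n => enorm (q - p)); first exact: dist_continuous.
move=> qF; exists c => //; rewrite -lee_fin; apply: le_trans qF.
by apply/ereal_infP => _ [_ -> [p Fp <-]]; rewrite lee_fin h.
Qed.

(** The thickening is the sum of [F] and a closed ball, hence the image of a
    compact product under addition. *)
Lemma thickening_compact F r : F !=set0 -> compact F ->
  compact (thickening F r).
Proof.
move=> F0 cF.
have -> : thickening F r =
    (fun x => x.1 + x.2) @` (F `*` [set v | enorm v <= r]).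
  apply/seteqP; split => [q /thickeningP[]// p Fp pr|q [[p v] /= [Fp vr] <-]].
    by exists (p, q - p) => //=; rewrite subrKC.
  by apply/thickeningP => //; exists p; rewrite // addrC addKr.
apply: continuous_compact.
  by apply: continuous_subspaceT => x; exact: add_continuous.
apply: compact_setX => //; apply: (@enorm_bounded_compact _ r) => //.
apply: (@closed_comp _ _ (@enorm R n) [set x | x <= r]); last exact: closed_le.
by move=> v _; exact: enorm_continuous.
Qed.

Lemma ereal_gt0_ge (x : \bar R) : (0 < x)%E ->
  exists2 e : R, 0 < e & (e%:E <= x)%E.
Proof.
case: x => [e|_|//]; first by rewrite lte_fin => e0; exists e.
by exists 1; rewrite ?leey.
Qed.

Lemma radius_gt0 U F : (0 < set_dist F (~` U))%E -> 0 < Defs.radius U F.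
Proof.
rewrite /Defs.radius; case: set_dist => [d|_|//].
  rewrite lte_fin -EFinM -EFin_min /= => d0.
  by rewrite lt_min ltr01 divr_gt0.
by rewrite gt0_mulye ?lte_fin// min_l ?leey.
Qed.

(** A point of the thickening outside [U] would be within half the distance from
    [F] to the complement of [U]. *)
Lemma thickening_radius_sub U F : F !=set0 -> compact F ->
  (0 < set_dist F (~` U))%E -> thickening F (Defs.radius U F) `<=` U.
Proof.
move=> F0 cF d0 q /thickeningP[]// p Fp; apply: contraPP => nUq.
have := set_dist_le Fp (nUq : (~` U) q); move: d0; rewrite /Defs.radius.
rewrite -enormN opprB.
case: set_dist => [d|//|//]; rewrite lte_fin lee_fin -EFinM -EFin_min /=.
move=> d0 le1 le2; have : d <= d * 2^-1.
  by rewrite (le_trans le1)// (le_trans le2)// ge_min lexx orbT.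
lra.
Qed.

Lemma set_max_ge (S : set R) x :
  (exists m, is_max S m) -> S x -> x <= set_max S.
Proof. by move=> /getPex [_ h] /h. Qed.

Lemma compact_is_max (T : topologicalType) (K : set T) (g : T -> R) :
  K !=set0 -> compact K -> (forall x, K x -> {for x, continuous g}) ->
  exists m, is_max (g @` K) m.
Proof.
move=> K0 cK gc; have [|c Kc h] := continuous_compact_min K0 cK (g := -%R \o g).
  by move=> x Kx; apply: continuousN; exact: gc.
exists (g c); split; first by exists c.
by move=> _ [x Kx <-]; have := h x Kx; rewrite /= lerN2.
Qed.

End compactness.

(** The positive distance to the complement of [U] keeps limit points of the
    sublevel set in [U], where continuity of [f] applies. *)
Lemma sublevel_compact (R : realType) (n : nat) (C U : set 'rV[R]_n)
    (f : 'rV[R]_n -> R) (a : R) :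
  compact C -> (forall p, U p -> {for p, continuous f}) ->
  (0 < set_dist (sublevel (C `&` U) f a) (~` U))%E ->
  compact (sublevel (C `&` U) f a).
Proof.
move=> cC fc d0; have Ccl := compact_closed (@norm_hausdorff _ _) cC.
apply: subclosed_compact cC _; last by move=> p [[]].
move=> p clp.
have Up : U p.
  apply: contrapT => nUp; have [e e0 ed] := ereal_gt0_ge d0.
  have : \forall y \near p, enorm (p - y) < e.
    have h := @dist_continuous R n p p; apply: (cvgr_lt _ h).
    by rewrite subrr enorm0.
  move=> /clp[y [Fy]]; apply/negP; rewrite -leNgt -lee_fin -enormN opprB.
  apply: le_trans ed _; exact: (set_dist_le Fy (nUp : (~` U) p)).
split; [split => //|].
  by apply: Ccl => B /clp[y [[[Cy _] _] By]]; exists y.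
rewrite leNgt; apply/negP => afp.
have /clp[y [[_ +]]] : \forall y \near p, a < f y.
  by exact: (cvgr_gt _ (fc p Up) _ afp).
by move=> /= fy /lt_geF; rewrite fy.
Qed.

(** * Spectral norm *)

Section spectral.
Context (R : realType) (n : nat).
Implicit Types (A : 'M[R]_n) (v : 'rV[R]_n).

Local Notation uball := [set v : 'rV[R]_n | enorm v <= 1].

Lemma uball_compact : compact uball.
Proof.
apply: (@enorm_bounded_compact _ _ _ 1) => //.
apply: (@closed_comp _ _ (@enorm R n) [set x | x <= 1]); last exact: closed_le.
by move=> v _; exact: enorm_continuous.
Qed.

Lemma uball0 : uball 0.
Proof. by rewrite /= enorm0 ler01. Qed.

Lemma enorm_mul_cvg (T : topologicalType) (H : T -> 'M[R]_n)
    (x : T * 'rV[R]_n) :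
  {for x.1, continuous H} ->
  {for x, continuous (fun y : T * 'rV[R]_n => enorm (y.2 *m (H y.1)^T))}.
Proof.
move=> cH; apply: (@enorm_cvg _ _ (nbhs x) _ n
  (fun y : T * 'rV[R]_n => y.2 *m (H y.1)^T)).
apply: (@mulmx_cvg _ _ (nbhs x) _ _ _ _ snd
  (fun y : T * 'rV[R]_n => (H y.1)^T)).
  exact: cvg_snd.
apply: (@trmx_cvg _ _ (nbhs x) _ _ _ (fun y : T * 'rV[R]_n => H y.1)).
apply: (@cvg_comp _ _ _ fst H (nbhs x) (nbhs x.1)); [exact: cvg_fst|exact: cH].
Qed.

Lemma spectral_norm_ub A v : enorm v <= 1 ->
  enorm (v *m A^T) <= spectral_norm A.
Proof.
move=> v1; apply: ub_le_sup; last by exists v.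
have [|m [_ ubm]] := compact_is_max (ex_intro _ _ uball0) uball_compact
  (g := fun v : 'rV[R]_n => enorm (v *m A^T)); last by exists m.
move=> w _; apply: (@enorm_cvg _ _ (nbhs w) _ n (fun y : 'rV[R]_n => y *m A^T)).
exact: (@mulmx_cvg _ _ (nbhs w) _ _ _ _ id (fun=> A^T) _ _
  (@cvg_id _ (nbhs w)) (cvg_cst _)).
Qed.

Lemma qform_le_spectral A v : qform A v <= spectral_norm A * dot v v.
Proof.
have -> : qform A v = dot v (v *m A^T).
  by rewrite /qform /dot trmx_mul trmxK mulmxA.
apply: le_trans (ler_norm _) _; apply: le_trans (cauchy_schwarz _ _) _.
rewrite -enorm_sqr expr2 mulrA [leRHS]mulrC ler_wpM2l ?enorm_ge0//.
have [v0|v0] := eqVneq (enorm v) 0.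
  by rewrite v0 mulr0 (enorm_eq0 v0) mul0mx enorm0.
have vgt0 : 0 < enorm v by rewrite lt_neqAle eq_sym v0 enorm_ge0.
rewrite -ler_pdivrMr//.
apply: le_trans (@spectral_norm_ub A ((enorm v)^-1 *: v) _).
  by rewrite -scalemxAl enormZ ger0_norm ?invr_ge0 ?enorm_ge0// mulrC.
by rewrite enormZ ger0_norm ?invr_ge0 ?enorm_ge0// mulVf.
Qed.

(** A maximum over [q] of a supremum over [v] is attained where the jointly
    continuous function of [(q, v)] attains its maximum on the compact product;
    this avoids continuity of the spectral norm itself. *)
Lemma spectral_norm_is_max (T : topologicalType) (K : set T)
    (H : T -> 'M[R]_n) :
  K !=set0 -> compact K -> (forall q, K q -> {for q, continuous H}) ->
  exists m, is_max [set spectral_norm (H q) | q in K] m.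
Proof.
move=> [q0 Kq0] cK cH.
have KB : (K `*` uball) !=set0 by exists (q0, 0); split => //=; exact: uball0.
have [|m [[[q v] /= [Kq v1] gm] ubm]] :=
    compact_is_max KB (compact_setX cK uball_compact)
      (g := fun y : T * 'rV[R]_n => enorm (y.2 *m (H y.1)^T)).
  by move=> x [/cH Hx _]; exact: enorm_mul_cvg.
have sle p : K p -> spectral_norm (H p) <= m.
  move=> Kp; apply: ge_sup.
    by exists (enorm (0 *m (H p)^T)), 0; [exact: uball0|].
  by move=> _ [w w1 <-]; apply: ubm; exists (p, w).
exists m; split; last by move=> _ [p Kp <-]; exact: sle.
exists q => //; apply/le_anti; rewrite sle//= -gm; exact: spectral_norm_ub.
Qed.

End spectral.

(** * Minimal curvature *)

Section curvature.
Context (R : realType) (n : nat) (f : 'rV[R]_n -> R) (F A : set 'rV[R]_n).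
Hypotheses (F0 : F !=set0) (cF : compact F)
  (hess_cont : forall p, F p -> {for p, continuous (hess f)}).

Lemma curvatures_is_min : lin A <> [set 0] ->
  is_min (curvatures f F (lin A)) (set_min (curvatures f F (lin A))).
Proof.
move=> A0; rewrite /set_min; apply: getPex.
pose S := [set v : 'rV[R]_n | lin A v /\ enorm v = 1].
have cS : compact S.
  apply: (@enorm_bounded_compact _ _ _ 1); last by move=> v [_ ->].
  apply: closedI; first exact: lin_closed.
  apply: (@closed_comp _ _ (@enorm R n) [set x | x = 1]); last exact: closed_eq.
  by move=> v _; exact: enorm_continuous.
have [p Fp] := F0.
have [v Av v0] : exists2 v, lin A v & v != 0.
  apply: contra_notP A0 => nv; apply/seteqP; split => v /=; last first.
    by move=> ->; exact: lin0.
  by move=> Av; apply/eqP/negPn/negP => v0; apply: nv; exists v.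
have S0 : S !=set0.
  exists ((enorm v)^-1 *: v); split; first exact: linZ.
  rewrite enormZ ger0_norm ?invr_ge0 ?enorm_ge0// mulVf//.
  by apply: contraNN v0 => /eqP/enorm_eq0 ->.
have FS : (F `*` S) !=set0 by have [w Sw] := S0; exists (p, w).
have [|c [Fc [Ac c1]] h] := continuous_compact_min FS (compact_setX cF cS)
    (g := fun x : 'rV[R]_n * 'rV[R]_n => qform (hess f x.1) x.2).
  move=> x [Fx _].
  apply: (@qform_cvg _ _ (nbhs x) _ n
    (fun x : 'rV[R]_n * 'rV[R]_n => hess f x.1) snd).
    apply: (@cvg_comp _ _ _ fst (hess f) (nbhs x) (nbhs x.1)).
      exact: cvg_fst.
    exact: (hess_cont Fx).
  exact: cvg_snd.
exists (qform (hess f c.1) c.2); split; first by exists c.1, c.2.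
by move=> _ [q [w [Fq Aw w1 ->]]]; apply: (h (q, w)).
Qed.

Lemma qform_ge_curvature p v : lin A <> [set 0] -> F p -> lin A v ->
  set_min (curvatures f F (lin A)) * dot v v <= qform (hess f p) v.
Proof.
move=> A0 Fp Av; have [_ h] := curvatures_is_min A0.
have [v0|v0] := eqVneq (enorm v) 0.
  by rewrite (enorm_eq0 v0) dot0l mulr0 /qform !mul0mx mxE.
have vgt0 : 0 < enorm v by rewrite lt_neqAle eq_sym v0 enorm_ge0.
rewrite -enorm_sqr -ler_pdivlMr ?exprn_gt0//; apply: h.
exists p, ((enorm v)^-1 *: v); split => //; first exact: linZ.
  by rewrite enormZ ger0_norm ?invr_ge0 ?enorm_ge0// mulVf.
rewrite /qform linearZ/= -!scalemxAl -scalemxAr !mxE; field.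
by [].
Qed.

End curvature.

(** * Strong convexity *)

Lemma sublevel_convex (R : realType) (n : nat) (C U : set 'rV[R]_n)
    (f : 'rV[R]_n -> R) (a : R) p q (t : R) :
  convex_set C -> convex_set U -> convex_function U f -> 0 <= t <= 1 ->
  sublevel (C `&` U) f a p -> sublevel (C `&` U) f a q ->
  sublevel (C `&` U) f a (p + t *: (q - p)).
Proof.
move=> vC vU vf t01 [[Cp Up] fp] [[Cq Uq] fq]; split.
  by split; exact: convex_set_segment.
apply: le_trans (convex_function_segment vf Up Uq t01) _.
by case/andP: t01 => t0 t1; nra.
Qed.

Section strong_convexity.
Context (R : realType) (n : nat) (f : 'rV[R]_n -> R).
Context (F : set 'rV[R]_n) (mu : R).
Hypothesis strong : forall p q, F p -> F q ->
  f p + dot (grad f p) (q - p) + mu * dot (q - p) (q - p) / 2 <= f q.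

(** At [x = p + t (q - p)], the strong convexity inequalities from [x] towards
    [p] and [q], averaged with weights [1 - t] and [t], bound [f x], hence
    [f p], by the convex combination of the values minus
    [mu * t * (1 - t) * |q - p|^2 / 2]; then [t] tends to [0].  This avoids the
    first-order optimality condition at [p]. *)
Lemma quadratic_growth p q :
  (forall t, 0 <= t <= 1 -> F (p + t *: (q - p))) ->
  (forall x, F x -> f p <= f x) ->
  mu * dot (q - p) (q - p) / 2 <= f q - f p.
Proof.
move=> Fpq pmin; rewrite -subr_le0.
apply: (@le0_of_le_small _ _ (mu * dot (q - p) (q - p) / 2)) => t /andP[t0 t1].
have t01 : 0 <= t <= 1 by rewrite !ltW.
have Fp : F p by have := Fpq 0; rewrite scale0r addr0 lexx ler01; exact.
have Fq : F q by have := Fpq 1; rewrite scale1r subrKC lexx ler01; exact.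
have Fx := Fpq t t01.
have := strong Fx Fq; have := strong Fx Fp; have := pmin _ Fx.
have -> : p - (p + t *: (q - p)) = (- t) *: (q - p).
  by rewrite opprD addNKr scaleNr.
have -> : q - (p + t *: (q - p)) = (1 - t) *: (q - p).
  by rewrite scalerBl scale1r opprD addrA.
move: (q - p) (grad f _) (f (p + t *: (q - p))) => d g fx.
rewrite !dotZl !dotZr; move: (dot g d) (dot d d) => s D h0 h1 h2.
rewrite -(ler_pM2l t0).
(* the weights 1 - t and t cancel the slopes - t * s and (1 - t) * s *)
have h3 : (1 - t) * (fx + - t * s + mu * (- t * (- t * D)) / 2) +
    t * (fx + (1 - t) * s + mu * ((1 - t) * ((1 - t) * D)) / 2) <=
    (1 - t) * f p + t * f q.
  by apply: lerD; rewrite ler_wpM2l//; lra.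
nra.
Qed.

End strong_convexity.

(** * One projected gradient step *)

Section gradient_step.
Context (R : realType) (n : nat) (C U : set 'rV[R]_n) (f : 'rV[R]_n -> R).
Hypotheses (C0 : C !=set0) (cC : compact C) (vC : convex_set C).
Implicit Types (x y : 'rV[R]_n) (a : R).

Local Notation disp x a := (trial C f x a - x).

Lemma trial_in x a : C (trial C f x a).
Proof. exact: proj_in. Qed.

(** The variational inequality of the projection of [x - a *: grad f x], tested
    at the point [x] of [C]. *)
Lemma step_descent x a : C x ->
  dot (disp x a) (disp x a) + a * dot (grad f x) (disp x a) <= 0.
Proof.
move=> Cx; have := proj_variational C0 cC vC (x - a *: grad f x) Cx.
rewrite -/(trial C f x a) (addrAC x) -(opprB (trial C f x a) x).
by move: (trial C f x a - x) (grad f x) => d g; rewrite !dot_lin; lra.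
Qed.

Lemma step_slope_le0 x a : C x -> 0 < a -> dot (grad f x) (disp x a) <= 0.
Proof.
move=> Cx a0; rewrite -(pmulr_rle0 _ a0).
by have := step_descent a Cx; have := dot_ge0 (disp x a); lra.
Qed.

Lemma step_length x a : C x -> 0 < a ->
  enorm (disp x a) <= a * enorm (grad f x).
Proof.
move=> Cx a0; have [->|d0] := eqVneq (enorm (disp x a)) 0.
  by rewrite mulr_ge0 ?enorm_ge0// ltW.
have dgt0 : 0 < enorm (disp x a) by rewrite lt_neqAle eq_sym d0 enorm_ge0.
rewrite -(ler_pM2r dgt0) -expr2 enorm_sqr.
have := step_descent a Cx; have := cauchy_schwarz (grad f x) (disp x a).
rewrite ler_norml => /andP[+ _].
by move=> /(ler_wpM2l (ltW a0)); lra.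
Qed.

(** The trial point minimizes the squared distance to [x - a *: grad f x], which
    at a point [z] is [|z - x|^2 + 2 * a * dot (grad f x) (z - x)] up to a
    constant; it is compared with the point [z] of the segment from [x] to [y] at
    parameter [t]. *)
Lemma step_model x y a t : C x -> C y -> 0 < a -> 0 <= t <= 1 ->
  2 * a * dot (grad f x) (disp x a) <=
  t ^+ 2 * dot (y - x) (y - x) + 2 * a * (t * dot (grad f x) (y - x)).
Proof.
move=> Cx Cy a0 t01.
have := proj_le C0 cC (x - a *: grad f x) (convex_set_segment vC Cx Cy t01).
have -> : x - a *: grad f x - (x + t *: (y - x)) =
    - (t *: (y - x)) - a *: grad f x.
  by rewrite opprD addrA (addrAC x) subrr add0r addrC.
rewrite -/(trial C f x a) (addrAC x) -(opprB (trial C f x a) x).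
have := dot_ge0 (disp x a).
move: (trial C f x a - x) (grad f x) (y - x) => d g e.
by rewrite !dot_lin (dotC d g) (dotC e g); nra.
Qed.

(** For [t] at most [mu * a], the quadratic term [t ^ 2 |y - x|^2 / (2 a)] of the
    model is at most [t * mu * |y - x|^2 / 2], which strong convexity absorbs: the
    slope of the step is at most [t * (f y - f x)], and the Armijo test turns a
    fraction [sigma] of it into actual decrease. *)
Lemma armijo_contraction F (mu : R) x y a (sigma : R) : 0 < sigma -> 0 < mu ->
  (forall p q, F p -> F q ->
    f p + dot (grad f p) (q - p) + mu * dot (q - p) (q - p) / 2 <= f q) ->
  F `<=` C -> F x -> F y -> 0 < a -> accepted C U f sigma x a ->
  f (trial C f x a) - f y <= (1 - sigma * Num.min 1 (mu * a)) * (f x - f y).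
Proof.
move=> s0 mu0 strong FC Fx Fy a0 [_ acc].
pose t := Num.min 1 (mu * a); rewrite -/t.
have t0 : 0 < t by rewrite lt_min ltr01 mulr_gt0.
have t1 : t <= 1 by rewrite ge_min lexx.
have tm : t <= mu * a by rewrite ge_min lexx orbT.
have t01 : 0 <= t <= 1 by rewrite ltW.
have := step_model (FC _ Fx) (FC _ Fy) a0 t01.
have := strong _ _ Fx Fy; have := dot_ge0 (y - x); move: acc.
move: (dot (grad f x) (trial C f x a - x)) (dot (y - x) (y - x)) => gd D.
move: (dot (grad f x) (y - x)) => ge.
move: (f (trial C f x a)) => fq acc D0 st h.
have h1 : t ^+ 2 * D <= t * (mu * a) * D.
  by rewrite expr2 ler_wpM2r// ler_wpM2l// ltW.
have h2 : gd <= t * (mu * D / 2 + ge).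
  rewrite -(ler_pM2l (_ : 0 < 2 * a)); last by rewrite mulr_gt0.
  by apply: le_trans h _; lra.
have h3 : gd <= t * (f y - f x).
  by apply: le_trans h2 _; rewrite ler_wpM2l ?(ltW t0)//; lra.
have h4 : sigma * gd <= sigma * (t * (f y - f x)) by rewrite ler_wpM2l// ltW.
lra.
Qed.

End gradient_step.

(** The loop shrinks only a rejected step size, and a rejected step size exceeds
    [astar]; so a step size obtained by shrinking exceeds [rho * astar]. *)
Lemma backtrack_ge (R : realType) (n : nat) (C U : set 'rV[R]_n)
    (f : 'rV[R]_n -> R) (sigma rho : R) x a b (astar : R) :
  0 < rho -> (forall c, 0 < c -> c <= astar -> accepted C U f sigma x c) ->
  backtrack C U f sigma rho x a b -> 0 < a ->
  [/\ accepted C U f sigma x b, 0 < b & Num.min a (rho * astar) <= b].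
Proof.
move=> rho0 acc; elim => [{}a acca a0|{}a {}b nacc _ IH a0].
  by split; rewrite // ge_min lexx.
have [accb b0 le] := IH (mulr_gt0 rho0 a0); split; [exact: accb|exact: b0|].
have aa : astar < a.
  by rewrite ltNge; apply/negP => aa; exact: (nacc (acc a a0 aa)).
apply: le_trans le; rewrite le_min !ge_min (ler_pM2l rho0) (ltW aa).
by rewrite lexx !orbT.
Qed.

(** * Acceptance of small steps *)

Section small_steps.
Context (R : realType) (n : nat) (C U : set 'rV[R]_n) (f : 'rV[R]_n -> R).
Context (F : set 'rV[R]_n) (sigma : R).
Hypotheses (C0 : C !=set0) (cC : compact C) (vC : convex_set C).
Hypotheses (f_C2 : twice_cont_diff U f) (s1 : 0 < sigma < 1).
Hypotheses (F0 : F !=set0) (cF : compact F) (FC : F `<=` C)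
  (dF : (0 < set_dist F (~` U))%E).

Let r := Defs.radius U F.
Let FU : F `<=` U.
Proof.
move=> p Fp; apply: (thickening_radius_sub F0 cF dF); apply/thickeningP => //.
by exists p => //; rewrite subrr enorm0 ltW// radius_gt0.
Qed.

Lemma grad_bound_ge p : F p -> enorm (grad f p) <= grad_bound f F.
Proof.
move=> Fp; rewrite /grad_bound le_max; apply/orP; right.
apply: set_max_ge; last by exists p.
apply: compact_is_max => // q Fq.
apply: (@enorm_cvg _ _ (nbhs q) _ n (grad f)).
by have [_ dg _] := f_C2 (FU Fq); exact: (differentiable_continuous dg).
Qed.

Lemma hess_bound_ge q : thickening F r q ->
  spectral_norm (hess f q) <= hess_bound f (thickening F r).
Proof.
move=> Kq; rewrite /hess_bound le_max; apply/orP; right.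
apply: set_max_ge; last by exists q.
apply: spectral_norm_is_max; [by exists q|exact: thickening_compact|].
by move=> p /(thickening_radius_sub F0 cF dF)/f_C2[].
Qed.

Lemma alpha_star_gt0 : 0 < alpha_star U f F sigma.
Proof.
case/andP: s1 => _ s2.
rewrite /alpha_star lt_min !divr_gt0 ?radius_gt0// ?mulr_gt0 ?subr_gt0//.
- by rewrite /hess_bound lt_max ltr01.
- by rewrite /grad_bound lt_max ltr01.
Qed.

(** With [G] and [L] the gradient and Hessian bounds, [a <= r / G] keeps the whole
    step in the thickening, where the Hessian norm is at most [L].  With [D] the
    squared step length and [s] its slope, Taylor gives an increase of at most
    [s + L * D / 2], while [D <= - a * s] and [a * L <= 2 * (1 - sigma)], so the
    increase is at most [sigma * s]. *)
Lemma small_step_accepted x a : F x -> 0 < a -> a <= alpha_star U f F sigma ->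
  accepted C U f sigma x a.
Proof.
move=> Fx a0; rewrite /alpha_star -/r le_min => /andP[ar aL].
set L := hess_bound f (thickening F r) in aL.
have L0 : 0 < L by rewrite /L /hess_bound lt_max ltr01.
have G0 : 0 < grad_bound f F by rewrite /grad_bound lt_max ltr01.
move: aL; rewrite ler_pdivlMr// => aL.
move: ar; rewrite ler_pdivlMr// => ar.
have Cx := FC Fx; rewrite /accepted.
set q := trial C f x a; pose d := q - x.
have dr : enorm d <= r.
  apply: le_trans (step_length f C0 cC vC Cx a0) _; apply: le_trans ar.
  by rewrite ler_wpM2l ?(ltW a0)// grad_bound_ge.
have seg t : 0 <= t <= 1 -> thickening F r (x + t *: d).
  move=> /andP[t0 t1]; apply/thickeningP => //; exists x => //.
  rewrite addrC addKr enormZ ger0_norm// (le_trans _ dr)//.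
  by rewrite ler_piMl ?enorm_ge0.
have segU t : 0 <= t <= 1 -> U (x + t *: d).
  by move=> /seg; exact: thickening_radius_sub.
have qE : q = x + d by rewrite /d subrKC.
split; first by rewrite qE; have := segU 1; rewrite scale1r lexx ler01; exact.
have := taylor_le f_C2 segU (m := L * dot d d).
rewrite -qE => h; apply: le_trans (h _) _.
  move=> t /seg/hess_bound_ge hb; apply: le_trans (qform_le_spectral _ _) _.
  by rewrite ler_wpM2r ?dot_ge0.
have := step_descent f C0 cC vC a Cx; have := step_slope_le0 f C0 cC vC Cx a0.
rewrite -/q -/d; move: (dot d d) (dot _ d) => D s s0 h1.
have : L * D <= L * (- a * s) by rewrite ler_wpM2l ?(ltW L0)//; lra.
have : a * L * (- s) <= 2 * (1 - sigma) * (- s) by rewrite ler_wpM2r//; lra.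
lra.
Qed.

End small_steps.

(** * Convergence of the method *)

Lemma iterates_contract (R : realType) (n : nat) (C U : set 'rV[R]_n)
    (f : 'rV[R]_n -> R) (F : set 'rV[R]_n) (y : 'rV[R]_n)
    (abar sigma rho eps gamma : R) (p : nat -> 'rV[R]_n) (k : nat) :
  0 <= gamma -> F (p 0%N) ->
  (forall x z, F x -> armijo_step C U f abar sigma rho eps x z ->
    F z /\ f z - f y <= gamma * (f x - f y)) ->
  armijo_iterates C U f abar sigma rho eps (p 0%N) p k ->
  F (p k) /\ f (p k) - f y <= gamma ^+ k * (f (p 0%N) - f y).
Proof.
move=> g0 F0 step [_]; elim: k => [|k IH] it; first by rewrite expr0 mul1r.
have [j jk|Fk fk] := IH _; first by apply: it; exact: ltnW.
have [Fz fz] := step _ _ Fk (it k (leqnn _)); split => //.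
by apply: le_trans fz _; rewrite exprS -mulrA ler_wpM2l.
Qed.

(** Differences of points of [C] lie in the span, so the minimal curvature bounds
    the second derivative of [f] along the segment. *)
Lemma strong_convexity_curvature (R : realType) (n : nat)
    (C U : set 'rV[R]_n) (f : 'rV[R]_n -> R) (F : set 'rV[R]_n) p q :
  twice_cont_diff U f -> F `<=` C `&` U -> compact F ->
  lin (set_diff C C) <> [set 0] ->
  (forall t, 0 <= t <= 1 -> F (p + t *: (q - p))) ->
  f p + dot (grad f p) (q - p) +
    set_min (curvatures f F (lin (set_diff C C))) * dot (q - p) (q - p) / 2
  <= f q.
Proof.
move=> f2 FCU cF LC0 seg.
have Fp : F p by have := seg 0; rewrite scale0r addr0 lexx ler01; exact.
have Fq : F q by have := seg 1; rewrite scale1r subrKC lexx ler01; exact.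
rewrite -[in leRHS](subrKC p q); apply: (taylor_ge f2).
  by move=> t /seg /FCU[].
move=> t /seg Fx; apply: qform_ge_curvature => //.
- by exists p.
- by move=> x /FCU[_ /f2[]].
- apply: lin_mem; exists q; first by case: (FCU _ Fq).
  by exists p => //; case: (FCU _ Fp).
Qed.

Theorem theorem3 (R : realType) (n : nat) (C U : set 'rV[R]_n)
    (f : 'rV[R]_n -> R) (p0 : 'rV[R]_n)
    (C_nonempty : C !=set0) (C_compact : compact C) (C_convex : convex_set C)
    (U_open : open U) (U_convex : convex_set U)
    (CU_nonempty : (C `&` U) !=set0)
    (f_C2 : twice_cont_diff U f) (f_convex : convex_function U f)
    (blow_up : forall a : R, sublevel (C `&` U) f a !=set0 ->
       (0 < set_dist (sublevel (C `&` U) f a) (~` U))%E)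
    (p0_in : (C `&` U) p0) :
  let F0 := sublevel (C `&` U) f (f p0) in
  let LC := lin (set_diff C C) in
  (forall p v, F0 p -> LC v -> enorm v = 1 -> 0 < qform (hess f p) v) ->
  exists pstar : 'rV[R]_n,
    unique (is_minimizer f (C `&` U)) pstar /\
    (LC <> [set 0] ->
     let mu := set_min (curvatures f F0 LC) in
     is_min (curvatures f F0 LC) mu /\
     forall abar sigma rho eps : R,
       0 < abar -> 0 < sigma < 1 -> 0 < rho < 1 -> 0 <= eps ->
       let gamma :=
         1 - sigma * Num.min 1 (mu * alpha_low U f F0 abar sigma rho) in
       0 < gamma < 1 /\
       forall (p : nat -> 'rV[R]_n) (k : nat),
         armijo_iterates C U f abar sigma rho eps p0 p k ->
         enorm (p k - pstar) <=
           Num.sqrt (2 * (f p0 - f pstar) / mu) * gamma `^ (k%:R / 2)).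
Proof.
move=> F0 LC curv.
have F0p : F0 p0 by split.
have F0n : F0 !=set0 by exists p0.
have FCU : F0 `<=` C `&` U by move=> x [].
have FC : F0 `<=` C by move=> x [[]].
have dF : (0 < set_dist F0 (~` U))%E by exact: blow_up.
have fcont p : U p -> {for p, continuous f}.
  by move=> /f_C2[df _ _]; exact: (differentiable_continuous df).
have cF : compact F0 by exact: sublevel_compact.
have seg p q t : F0 p -> F0 q -> 0 <= t <= 1 -> F0 (p + t *: (q - p)).
  by move=> Fp Fq t01; exact: sublevel_convex.
have [|ps Fps psmin] := continuous_compact_min F0n cF (g := f).
  by move=> x /FCU[_ /fcont].
have pmin q : (C `&` U) q -> f ps <= f q.
  move=> CUq; have [fq|fq] := leP (f q) (f p0); first by apply: psmin; split.
  by rewrite (le_trans (psmin _ F0p))// ltW.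
pose mu := set_min (curvatures f F0 LC).
have muP : LC <> [set 0] -> is_min (curvatures f F0 LC) mu.
  by move=> LC0; apply: curvatures_is_min => // x /FCU[_ /f_C2[]].
have mu_gt0 : LC <> [set 0] -> 0 < mu.
  by move=> /muP[[p [v [Fp Lv v1 ->]]] _]; exact: curv.
have strong : LC <> [set 0] -> forall p q, F0 p -> F0 q ->
    f p + dot (grad f p) (q - p) + mu * dot (q - p) (q - p) / 2 <= f q.
  move=> LC0 p q Fp Fq; apply: (strong_convexity_curvature f_C2 FCU) => //.
  by move=> t; exact: seg.
have growth : LC <> [set 0] -> forall q, F0 q ->
    mu * dot (q - ps) (q - ps) / 2 <= f q - f ps.
  move=> LC0 q Fq; apply: (quadratic_growth (strong LC0)) => // t.
  exact: seg.
exists ps; split.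
  split; first by split=> //; exact: FCU.
  move=> q [CUq qmin]; have Fq : F0 q by split=> //; exact: qmin.
  suff : q - ps = 0 by move/eqP; rewrite subr_eq0 => /eqP ->.
  have [LC0|LC0] := pselect (LC = [set 0]).
    (* here C is a single point, and no curvature is available *)
    suff : LC (q - ps) by rewrite LC0.
    by apply: lin_mem; exists q; [exact: FC|exists ps => //; exact: FC].
  apply: enorm_eq0; apply/eqP; rewrite -sqrf_eq0 enorm_sqr eq_le dot_ge0 andbT.
  rewrite -(pmulr_rle0 _ (mu_gt0 LC0)).
  have := growth LC0 q Fq; have := qmin ps (FCU _ Fps); lra.
move=> LC0; rewrite -/mu; split; first exact: muP.
have {muP mu_gt0}mu0 := mu_gt0 LC0.
have {}strong := strong LC0; have {}growth := growth LC0.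
move=> abar sigma rho eps abar0 s01 /andP[rho0 _] _ gamma.
have [s0 s1] := andP s01.
have as0 : 0 < alpha_star U f F0 sigma by exact: alpha_star_gt0.
set al := alpha_low U f F0 abar sigma rho in gamma *.
have al0 : 0 < al by rewrite /al lt_min abar0 mulr_gt0.
have m0 : 0 < Num.min 1 (mu * al) by rewrite lt_min ltr01 mulr_gt0.
have m1 : Num.min 1 (mu * al) <= 1 by rewrite ge_min lexx.
have g0 : 0 < gamma by rewrite /gamma; nra.
have g1 : gamma < 1 by rewrite /gamma; nra.
split; first by rewrite g0.
move=> p k it.
have step x z : F0 x -> armijo_step C U f abar sigma rho eps x z ->
    F0 z /\ f z - f ps <= gamma * (f x - f ps).
  move=> Fx [a [bt -> _]].
  have small c : 0 < c -> c <= alpha_star U f F0 sigma ->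
    accepted C U f sigma x c by exact: small_step_accepted.
  have [acc a0 ala] := backtrack_ge rho0 small bt abar0.
  have Cx := FC _ Fx; have [Uz fz] := acc.
  have sl := step_slope_le0 f C_nonempty C_compact C_convex Cx a0.
  split.
    split; first by split => //; exact: trial_in.
    apply: le_trans fz _; have [_ fx] := Fx; apply: le_trans fx.
    by rewrite gerDl mulr_ge0_le0// ltW.
  apply: le_trans (armijo_contraction C_nonempty C_compact C_convex s0 mu0
    strong FC Fx Fps a0 acc) _.
  rewrite ler_wpM2r ?subr_ge0 ?psmin// lerB// ler_wpM2l ?(ltW s0)//.
  rewrite le_min !ge_min lexx /=; apply/orP; right.
  by rewrite ler_wpM2l// ltW.
case: (it) => p0E _; rewrite -p0E in it F0p *.
have [Fk fk] := iterates_contract (ltW g0) F0p step it.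
have D0 : 0 <= f (p 0%N) - f ps by rewrite subr_ge0 psmin.
rewrite -(@ler_pXn2r _ 2)// ?nnegrE ?mulr_ge0 ?enorm_ge0 ?sqrtr_ge0 ?powR_ge0//.
rewrite enorm_sqr exprMn sqr_sqrtr; last by rewrite divr_ge0 ?mulr_ge0// ltW.
have -> : (gamma `^ (k%:R / 2)) ^+ 2 = gamma ^+ k.
  by rewrite -powR_mulrn ?powR_ge0//
    -powRrM divfK ?pnatr_eq0// powR_mulrn// ltW.
rewrite mulrAC ler_pdivlMr//.
have := growth _ Fk; lra.
Qed.
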